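(* Consider the problem of minimizing $F(x)=f(x)+h(x)$ over $x\in\mathbb{R}^N$, where $f(x)=\mathbb{E}_\xi[f(x;\xi)]$, and suppose that Assumptions A and B of the context are satisfied. If the (inexact) adaptive stochastic proximal gradient method described in the context is run for $T$ iterations with non-increasing step sizes $\alpha_t$ such that $\alpha_0<\delta/(2L)$, then its output $x_R$, where $R$ is sampled uniformly in $\{1,\ldots,T\}$, satisfies $$\mathbb{E}_R\big[\operatorname{dist}\big(0,\widehat\partial F(x_R)\big)^2\big]\le\frac{C_1}{T}\sum_{t=0}^{T-1}\|g_t-\nabla f(x_t)\|_2^2+\frac{C_2\Delta}{T}+\frac{C_3}{T},$$ where $\Delta=F(x_0)-F(x^\star)$, $x^\star$ is a minimizer of $F$, and $C_1,C_2,C_3$ are positive constants independent of $T$.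
   Context: Notation. For $F:\mathbb{R}^N\to\overline{\mathbb{R}}$ (possibly non-convex) finite at $\bar x$, the Fréchet subdifferential is $$\widehat\partial F(\bar x)=\Big\{v\in\mathbb{R}^N:\ \liminf_{x\to\bar x,\,x\ne\bar x}\frac{F(x)-F(\bar x)-\langle v,x-\bar x\rangle}{\|x-\bar x\|_2}\ge0\Big\}.$$ $\operatorname{dist}(z,S)$ is the minimal distance of any point of the set $S$ to the point $z$. For a positive definite matrix $D$, $\|z\|_D^2=\langle z,Dz\rangle$, and $\operatorname{prox}^{D}_{\alpha h}(x)=\operatorname{argmin}_{z}\frac12\|z-x\|_D^2+\alpha h(z)$ is the weighted proximal operator of $h$. The loss $f$ is differentiable; the penalty function $h$ may be non-convex and non-differentiable. Algorithm. Given $x_0$, step sizes $(\alpha_t)_{t\ge0}$, an initial mean estimate and an initial preconditioning matrix, for $t=0,\ldots,T-1$: draw a minibatch $\xi_t$; update the estimate $m_t$ of the mean of the gradients with the stochastic gradient $g_t=\nabla f(x_t;\xi_t)$, using the momentum parameter $\rho_t$, i.e. $m_t=(1-\rho_t)g_t+\rho_tm_{t-1}$ (for $t=0$, $m_{t-1}$ stands for the initial mean estimate); update the diagonal preconditioning matrix $D_t$; let $x_{t+1}^\star=\operatorname{prox}_{\alpha_th}^{D_t}(x_t-\alpha_tD_t^{-1}m_t)$ be the exact proximal update, and let $x_{t+1}$ be $x_{t+1}^\star$ or an approximation of it as specified in Assumption B. The output is $x_R$ with $R$ sampled uniformly in $\{1,\ldots,T\}$. Assumption A. (1) $f$ is $L$-smooth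 and lower-bounded: $f(x^\star)>-\infty$ for the optimal solution $x^\star$, and $\|\nabla f(x)-\nabla f(y)\|_2\le L\|x-y\|_2$ for all $x,y$. (2) The stochastic gradient $g_t=\nabla f(x_t;\xi_t)$ is unbiased with bounded variance: $\mathbb{E}_\xi[g_t]=\nabla f(x_t)$ and $\mathbb{E}_\xi[\|g_t-\nabla f(x_t)\|_2^2]\le\sigma^2$. (3) The update and the stochastic gradient are bounded, $\|x_{t+1}-x_t\|_2\le D$ and $\|g_t\|_2\le G$, and the momentum parameter is exponentially decaying, $\rho_t=\rho_0\mu^t$ with $\mu\in[0,1)$. (4) For all $t$, $D_t\succeq\delta I$ (i.e. $D_t-\delta I$ is positive semi-definite) and $\alpha_tD_t^{-1}\succeq\gamma I$, with $\delta,\gamma>0$. Assumption B. For all $t\ge0$, either (1) $x_{t+1}=x_{t+1}^\star$ is the exact proximal update, or (2) $x_{t+1}$ is an $\varepsilon_{t+1}$-approximation of $x_{t+1}^\star$, $\|x_{t+1}-x_{t+1}^\star\|_2\le\varepsilon_{t+1}$, and $h$ is $L'$-smooth (differentiable with $L'$-Lipschitz gradient) in the $\varepsilon_{t+1}$-ball around $x_{t+1}^\star$ (which contains $x_{t+1}$). Moreover, with the convention $\varepsilon_{t+1}=0$ if $x_{t+1}=x_{t+1}^\star$, $\sum_{t=0}^{+\infty}\varepsilon_{t+1}^2=K<+\infty$. *)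

(* Defs.v *)
From HB Require Import structures.
From mathcomp Require Import all_boot all_order all_algebra.
From mathcomp Require Import all_classical all_reals all_analysis.

Set Implicit Arguments.
Unset Strict Implicit.
Unset Printing Implicit Defensive.

Import Order.TTheory GRing.Theory Num.Theory.
Import numFieldNormedType.Exports.

Local Open Scope classical_set_scope.
Local Open Scope ring_scope.

Section EuclideanSpace.
Context {R : realType} {N : nat}.
Implicit Types (x y z v : 'cV[R]_N) (M : 'M[R]_N) (S : set 'cV[R]_N).

Definition dotp x y : R := \sum_i x i 0 * y i 0.

(* The library norm on matrices is the sup norm. It induces the same topology,
   so library limits and differentiability are unaffected, but the constants
   and the distance below refer to the Euclidean norm. *)
Definition enorm x : R := Num.sqrt (dotp x x).

(* Takes the value +oo on the empty set. *)
Definition setdist z S : \bar R := ereal_inf [set (enorm (z - s))%:E | s in S].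

Definition psd M : Prop := M^T = M /\ forall z, 0 <= dotp z (M *m z).

(* The squared weighted norm. *)
Definition wsqnorm M z : R := dotp z (M *m z).

Definition grad (f : 'cV[R]_N -> R) x : 'cV[R]_N :=
  \col_i 'D_(delta_mx i 0) f x.

Definition smooth (L : R) (f : 'cV[R]_N -> R) : Prop :=
  (forall x, differentiable f x) /\
  (forall x y, enorm (grad f x - grad f y) <= L * enorm (x - y)).

(* Differentiability of an extended-real function at x includes finiteness
   on a full neighbourhood of x, also when x is on the boundary of S. *)
Definition smooth_on S (L : R) (h : 'cV[R]_N -> \bar R) : Prop :=
  (forall x, S x ->
     (\forall y \near x, h y \is a fin_num) /\ differentiable (fine \o h) x) /\
  (forall x y, S x -> S y ->
     enorm (grad (fine \o h) x - grad (fine \o h) y) <= L * enorm (x - y)).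

(* Empty at the points where F is not finite. *)
Definition frechet_subdiff (F : 'cV[R]_N -> \bar R) x : set 'cV[R]_N :=
  [set v | F x \is a fin_num /\
    (0 <= limf_einf
       (fun y => (F y - F x - (dotp v (y - x))%:E) * ((enorm (y - x))^-1)%:E)
       x^')%E].

(* The set of minimizers: for a non-convex h it need not be a singleton. *)
Definition prox M (a : R) (h : 'cV[R]_N -> \bar R) x : set 'cV[R]_N :=
  [set z | forall y, ((2^-1 * wsqnorm M (z - x))%:E + a%:E * h z <=
                      (2^-1 * wsqnorm M (y - x))%:E + a%:E * h y)%E].

Definition minimizer (F : 'cV[R]_N -> \bar R) x : Prop :=
  forall y, (F x <= F y)%E.

Definition proper_ereal (h : 'cV[R]_N -> \bar R) : Prop :=
  (forall x, h x != -oo%E) /\ (exists x, (h x < +oo)%E).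

Definition composite (f : 'cV[R]_N -> R) (h : 'cV[R]_N -> \bar R) x : \bar R :=
  ((f x)%:E + h x)%E.

Fixpoint mean_est (rho : nat -> R) (m_init : 'cV[R]_N)
    (g : nat -> 'cV[R]_N) (t : nat) : 'cV[R]_N :=
  (1 - rho t) *: g t +
  rho t *: (if t is s.+1 then mean_est rho m_init g s else m_init).

(* loss x s is the loss f(x; s) of the minibatch s, and xi the drawn
   minibatches. *)
Definition stoch_grad (Omega Xi : Type) (loss : 'cV[R]_N -> Xi -> R)
    (xi : nat -> Omega -> Xi) (x : nat -> Omega -> 'cV[R]_N)
    (t : nat) (w : Omega) : 'cV[R]_N :=
  grad (loss ^~ (xi t w)) (x t w).

End EuclideanSpace.

Section UniformLaw.
Context (R : realType).

Lemma invn_ge0 (T : nat) : 0 <= (T%:R : R)^-1.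
Proof. by rewrite invr_ge0 ler0n. Qed.

(* The uniform law on {1, ..., T}. *)
Definition unif_law (T : nat) : {measure set nat -> \bar R} :=
  mscale (NngNum (invn_ge0 T))
    (msum (fun k => \d_k.+1 : {measure set nat -> \bar R}) T).

Lemma unif_law1 (T k : nat) :
  unif_law T [set k] = (if (0 < k <= T)%N then (T%:R)^-1 else 0)%:E.
Proof.
transitivity (((T%:R)^-1)%:E * (\sum_(n < T) (\d_n.+1 [set k] : \bar R)))%E => //.
have E : (\sum_(n < T) (\d_n.+1 [set k] : \bar R))%E = ((0 < k <= T)%N%:R : R)%:E.
  under eq_bigr do rewrite diracE.
  case: k => [|k] /=.
    by rewrite big1// => i _; rewrite memNset.
  case: (ltnP k T) => kT.
    rewrite (bigD1 (Ordinal kT))//= mem_set// big1 ?adde0// => i ik.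
    by rewrite memNset// => -[] ik'; move/eqP: ik; apply; apply: val_inj.
  rewrite big1// => i _; rewrite memNset// => -[] ik.
  by move: (ltn_ord i); rewrite ik ltnNge kT.
by rewrite E -EFinM; case: ifP => _; rewrite ?mulr1 ?mulr0.
Qed.

Lemma unif_lawT (T : nat) : (0 < T)%N -> unif_law T setT = 1%E.
Proof.
move=> T0.
transitivity (((T%:R)^-1)%:E * (\sum_(n < T) (\d_n.+1 setT : \bar R)))%E => //.
under eq_bigr do rewrite diracT.
rewrite sumEFin sumr_const card_ord -EFinM mulVf//.
by rewrite pnatr_eq0 -lt0n.
Qed.

End UniformLaw.

(* Main.v *)
(* One step of the method decreases F by a multiple of |e_t|^2, where
   e_t = x*_{t+1} - x_t, up to terms in |m_t - grad f(x_t)|^2 and eps_{t+1}^2: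
   compare x*_{t+1} with x_t in the proximal minimization, and use
   D_t / (2 alpha_t) >= delta / (2 alpha_0) > L against the error L |e_t|^2 in
   the expansion of f. Telescoping bounds the sum of the |e_t|^2. Completing the
   square in the same minimization shows that
   q = - m_t - D_t e_t / alpha_t is a proximal subgradient of h at x*_{t+1}, so
   grad f + q is a subgradient of F there whose square is controlled by the same
   three quantities; this survives the passage to an inexact x_{t+1} because h is
   then smooth around x*_{t+1}. Finally m_t - g_t is geometrically small, since
   rho_t = rho_0 mu^t and the momentum stays bounded. All of this holds along
   every realization of the minibatches. *)

Require Import Defs.
From HB Require Import structures.
From mathcomp Require Import all_boot all_order all_algebra.
From mathcomp Require Import all_classical all_reals all_analysis.
From mathcomp Require Import ring lra.

Set Implicit Arguments.
Unset Strict Implicit.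
Unset Printing Implicit Defensive.

Import Order.TTheory GRing.Theory Num.Theory.
Import numFieldNormedType.Exports.

Local Open Scope classical_set_scope.
Local Open Scope ring_scope.

(** * Euclidean inner product: quadratic inequalities and comparison with the sup norm *)

Section EuclideanGeometry.
Context {R : realType} {N : nat}.
Implicit Types (x y z u v : 'cV[R]_N).

Lemma dotpC x y : dotp x y = dotp y x.
Proof. by apply: eq_bigr => i _; rewrite mulrC. Qed.

Lemma dotpDl x y z : dotp (x + y) z = dotp x z + dotp y z.
Proof. by rewrite -big_split; apply: eq_bigr => i _; rewrite mxE mulrDl. Qed.

Lemma dotpZl (a : R) x y : dotp (a *: x) y = a * dotp x y.
Proof. by rewrite mulr_sumr; apply: eq_bigr => i _; rewrite mxE mulrA. Qed.

Lemma dotpNl x y : dotp (- x) y = - dotp x y.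
Proof. by rewrite -scaleN1r dotpZl mulN1r. Qed.

Lemma dotpBl x y z : dotp (x - y) z = dotp x z - dotp y z.
Proof. by rewrite dotpDl dotpNl. Qed.

Lemma dotpDr x y z : dotp x (y + z) = dotp x y + dotp x z.
Proof. by rewrite !(dotpC x) dotpDl. Qed.

Lemma dotpZr (a : R) x y : dotp x (a *: y) = a * dotp x y.
Proof. by rewrite !(dotpC x) dotpZl. Qed.

Lemma dotpNr x y : dotp x (- y) = - dotp x y.
Proof. by rewrite !(dotpC x) dotpNl. Qed.

Definition dotpE := (dotpDl, dotpDr, dotpNl, dotpNr, dotpZl, dotpZr).

Lemma dotpp_ge0 x : 0 <= dotp x x.
Proof. by apply: sumr_ge0 => i _; rewrite -expr2 sqr_ge0. Qed.

Lemma dotpp_eq0 x : dotp x x = 0 -> x = 0.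
Proof.
move=> /eqP; rewrite psumr_eq0 => [/allP x0|i _]; last by rewrite -expr2 sqr_ge0.
apply/matrixP => i j; rewrite mxE (ord1 j).
by have := x0 i (mem_index_enum i); rewrite /= mulf_eq0 orbb => /eqP.
Qed.

(** Expand [0 <= |x - c y|^2] and divide by [c]. The weight [c] decides later which of the two terms
    is absorbed. *)
Lemma dotp_young (c : R) x y : 0 < c ->
  2 * dotp x y <= c^-1 * dotp x x + c * dotp y y.
Proof.
move=> c0; have := dotpp_ge0 (x - c *: y); rewrite !dotpE (dotpC y x) => H.
have -> : c^-1 * dotp x x + c * dotp y y = c^-1 * (dotp x x + c * (c * dotp y y)).
  by field; rewrite gt_eqF.
by rewrite ler_pdivlMl//; lra.
Qed.

Lemma dotpp_sum2 x y : dotp (x + y) (x + y) <= 2 * (dotp x x + dotp y y).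
Proof. have := dotpp_ge0 (x - y); rewrite !dotpE (dotpC y x) => H; lra. Qed.

Lemma dotpp_sum3 x y z :
  dotp (x + y + z) (x + y + z) <= 3 * (dotp x x + dotp y y + dotp z z).
Proof.
have := dotpp_ge0 (x - y); have := dotpp_ge0 (x - z); have := dotpp_ge0 (y - z).
rewrite !dotpE (dotpC y x) (dotpC z x) (dotpC z y) => H1 H2 H3; lra.
Qed.

Lemma enorm_ge0 x : 0 <= enorm x.
Proof. exact: sqrtr_ge0. Qed.

Lemma sqr_enorm x : enorm x ^+ 2 = dotp x x.
Proof. by rewrite sqr_sqrtr// dotpp_ge0. Qed.

Lemma enorm_gt0 x : x != 0 -> 0 < enorm x.
Proof.
move=> x0; rewrite sqrtr_gt0 lt_neqAle dotpp_ge0 andbT eq_sym.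
by apply: contra_neq x0 => /dotpp_eq0.
Qed.

Lemma enormZ (a : R) x : enorm (a *: x) = `|a| * enorm x.
Proof.
by rewrite /enorm !dotpE mulrA -expr2 sqrtrM ?sqr_ge0// sqrtr_sqr.
Qed.

Lemma norm_coord_le x i : `|x i 0| <= `|x|.
Proof.
rewrite [leRHS]/Num.norm /= mx_normrE; apply/bigmax_geP; right.
by exists (i, 0).
Qed.

Lemma norm_le_enorm x : `|x| <= enorm x.
Proof.
rewrite [leLHS]/Num.norm /= mx_normrE; apply/bigmax_leP; split; first exact: enorm_ge0.
move=> [i j] _ /=; rewrite (ord1 j) -sqrtr_sqr ler_sqrt ?dotpp_ge0//.
by rewrite /dotp (bigD1 i)//= -expr2 lerDl sumr_ge0// => k _; rewrite -expr2 sqr_ge0.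
Qed.

Lemma dotpp_le_norm x : dotp x x <= N%:R * `|x| ^+ 2.
Proof.
apply: le_trans (_ : \sum_(i < N) `|x| ^+ 2 <= _).
  apply: ler_sum => i _; rewrite -expr2 -real_normK ?num_real//.
  by rewrite lerXn2r ?nnegrE// norm_coord_le.
by rewrite sumr_const card_ord mulr_natl.
Qed.

(** Neighbourhoods are those of the sup norm, so the radius is transferred through
    [|z|_2^2 <= N |z|^2]. *)
Lemma near_enorm x (e : R) : 0 < e -> \forall y \near x, enorm (y - x) <= e.
Proof.
(* The radius [e / (N + 1)] makes sense also for [N = 0], and [N <= (N + 1)^2] suffices. *)
move=> e0; pose c := N%:R + 1 : R.
have c0 : 0 < c by rewrite ltr_wpDl.
have : \forall y \near x, `|y - x| <= e / c.
  have ec0 : 0 < e / c by rewrite divr_gt0.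
  near=> y; rewrite distrC; near: y.
  by apply: (@cvgr_dist_le _ _ _ (nbhs x) _ id x) => //; exact: cvg_id.
apply: filterS => y yx; rewrite -(ger0_norm (ltW e0)) -sqrtr_sqr ler_sqrt ?sqr_ge0//.
apply: (le_trans (dotpp_le_norm _)).
apply: (@le_trans _ _ (N%:R * (e / c) ^+ 2)).
  by apply: ler_wpM2l => //; rewrite lerXn2r ?nnegrE// divr_ge0 ?ltW.
have -> : N%:R * (e / c) ^+ 2 = e ^+ 2 * (N%:R / c ^+ 2).
  by field; rewrite gt_eqF.
rewrite ler_piMr ?sqr_ge0// ler_pdivrMr ?exprn_gt0// mul1r /c.
have : (0 : R) <= N%:R by []. nra.
Unshelve. all: by end_near. Qed.

End EuclideanGeometry.

(** * Gradients and first-order expansions *)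

Section Gradient.
Context {R : realType} {N : nat}.
Implicit Types (f : 'cV[R]_N -> R) (x y z u v d : 'cV[R]_N).

Lemma diff_dotp f x d : differentiable f x -> 'd f x d = dotp (grad f x) d.
Proof.
move=> dfx; have -> : d = \sum_i d i 0 *: (delta_mx i 0 : 'cV[R]_N).
  by rewrite [LHS]matrix_sum_delta; apply: eq_bigr => i _; rewrite big_ord1.
rewrite linear_sum /dotp; apply: eq_bigr => i _.
rewrite linearZ/= mxE deriveE// mulrC; congr (_ * _).
rewrite summxE (bigD1 i)//= !mxE !eqxx mulr1 big1 ?addr0// => j ji.
by rewrite !mxE eq_sym (negbTE ji) mulr0.
Qed.

Lemma grad_near f x (e : R) : differentiable f x -> 0 < e ->
  \forall y \near x,
    `|f y - f x - dotp (grad f x) (y - x)| <= e * enorm (y - x).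
Proof.
move=> dfx e0; have /eqaddoP /(_ e e0) := diff_locally dfx.
move=> H.
have {}H : \forall y \near x, `|f y - (f x + 'd f x (y - x))| <= e * `|y - x|.
  rewrite (near_shift 0 x) subr0; apply: filterS H => y /=.
  by rewrite !fctE /= addrK.
apply: filterS H => y; rewrite diff_dotp// opprD addrA => /le_trans; apply.
by rewrite ler_pM2l// norm_le_enorm.
Qed.

(** The difference quotients of the restriction to the line coincide with those of [f] in direction
    [d] at [x + s *: d]. *)
Lemma is_derive_line f x d (s : R) : differentiable f (x + s *: d) ->
  is_derive s 1 (fun t => f (x + t *: d)) (dotp (grad f (x + s *: d)) d).
Proof.
move=> df; have E : (fun t : R => t^-1 *: (((fun t => f (x + t *: d)) \o shift s)
    (t *: (1 : R)) - f (x + s *: d))) =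
    (fun t : R => t^-1 *: ((f \o shift (x + s *: d)) (t *: d) - f (x + s *: d))).
  apply/funext => t /=; congr (_ *: (f _ - _)).
  by rewrite scalerDl -[t *: 1]/(t * 1) mulr1 addrCA addrA addrC addrA.
have dv := diff_derivable (v := d) df.
split; first by rewrite /derivable E.
by rewrite /derive E -diff_dotp// -deriveE.
Qed.

(* The mean value theorem gives the constant M; the sharp M / 2 is not needed. *)
Lemma grad_expansion f x d (M : R) : 0 < M ->
  (forall s : R, 0 <= s <= 1 -> differentiable f (x + s *: d)) ->
  (forall s : R, 0 <= s <= 1 ->
     enorm (grad f (x + s *: d) - grad f x) <= M * enorm (s *: d)) ->
  `|f (x + d) - f x - dotp (grad f x) d| <= M * dotp d d.
Proof.
move=> M0 df lipf.
pose phi t := f (x + t *: d).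
pose dphi s := dotp (grad f (x + s *: d)) d.
have dphiP (s : R) : 0 <= s <= 1 -> is_derive s 1 phi (dphi s).
  by move=> s01; exact: is_derive_line (df _ s01).
have [s s01] : exists2 s, s \in `]0, 1[ & phi 1 - phi 0 = dphi s * (1 - 0).
  apply: MVT => //.
    by move=> s /[!in_itv]/= /andP[s0 s1]; apply: dphiP; rewrite !ltW.
  apply: derivable_within_continuous => s /[!in_itv]/= s01.
  by have [] := dphiP s s01.
rewrite /phi /dphi scale1r scale0r addr0 subr0 mulr1 => ->; rewrite -dotpBl.
have {}s01 : 0 <= s <= 1 by move: s01; rewrite in_itv/= => /andP[/ltW-> /ltW->].
set a := _ - grad f x.
have aM : dotp a a <= M ^+ 2 * dotp d d.
  rewrite -!sqr_enorm -exprMn lerXn2r ?nnegrE ?enorm_ge0//.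
    by rewrite mulr_ge0 ?enorm_ge0 ?ltW.
  apply: le_trans (lipf s s01) _; rewrite ler_pM2l// enormZ.
  by case/andP: s01 => s0 s1; rewrite ger0_norm// ler_piMl ?enorm_ge0.
clearbody a; have aM' : M^-1 * dotp a a <= M * dotp d d.
  by rewrite ler_pdivrMl// mulrA -expr2.
(* Young's inequality with weight [M], for [a] and [- a], replaces Cauchy-Schwarz: each of the two
   terms is at most [M * dotp d d]. *)
have := dotp_young a d M0; have := dotp_young (- a) d M0.
rewrite !dotpE opprK => H1 H2; rewrite ler_norml; apply/andP; split; lra.
Qed.

End Gradient.

(** * Fréchet subgradients from lower bounds *)

Section Subdifferential.
Context {R : realType} {N : nat}.
Implicit Types (h F : 'cV[R]_N -> \bar R) (x y z u v q : 'cV[R]_N).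

(** The lower limit is a supremum of infima over punctured neighbourhoods; the one where the bound
    for [e] holds contributes at least [- e]. *)
Lemma frechet_subdiffI F x v : F x \is a fin_num ->
  (forall e : R, 0 < e -> \forall y \near x,
     (F x + (dotp v (y - x) - e * enorm (y - x))%:E <= F y)%E) ->
  frechet_subdiff F x v.
Proof.
move=> Fx lbF; split=> //; apply/lee_addgt0Pr => e e0; rewrite limf_einfE.
rewrite -leeBlDr// sub0e.
pose V y := y != x /\ (F x + (dotp v (y - x) - e * enorm (y - x))%:E <= F y)%E.
have nV : x^' V.
  rewrite /dnbhs /within /=; near=> y => yx; split=> //.
  by near: y; exact: lbF.
apply: le_trans (_ : ereal_inf ((fun y => (F y - F x - (dotp v (y - x))%:E) *
  ((enorm (y - x))^-1)%:E)%E @` V) <= _)%E; last by apply: ereal_sup_ubound; exists V.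
apply: le_ereal_inf_tmp => _ [y [yx + <-]].
have n0 : 0 < enorm (y - x) by rewrite enorm_gt0// subr_eq0.
move: Fx; case: (F x) => // a _; case: (F y) => [b| |//].
  rewrite -EFinD lee_fin -!EFinB -EFinM -EFinN lee_fin => ab.
  by rewrite ler_pdivlMr//; lra.
(* Where [F y] is [+oo], so is the quotient. *)
by move=> _; rewrite -!EFinN !addye// mulyr gtr0_sg ?invr_gt0// mul1e leey.
Unshelve. all: by end_near. Qed.

(** If [p], the gradient minus [q], were nonzero, a short move from [x] along [- p] would change [h]
    to first order by [- s |p|^2] relative to [q], more than the quadratic term and the
    differentiability error together allow. *)
Lemma grad_eq_of_lower_bound h x q (c : R) : 0 <= c ->
  (\forall y \near x, h y \is a fin_num) -> differentiable (fine \o h) x ->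
  (forall y, (h x + (dotp q (y - x) - c * dotp (y - x) (y - x))%:E <= h y)%E) ->
  grad (fine \o h) x = q.
Proof.
move=> c0 hfin dh lbh; apply/eqP; rewrite -subr_eq0; apply/negPn/negP => p0.
set p := _ - q in p0; have n0 := enorm_gt0 p0.
have : \forall y \near x,
    - (enorm p / 2) * enorm (y - x) - c * dotp (y - x) (y - x) <= dotp p (y - x).
  have hx := nbhs_singleton hfin.
  have e0 : 0 < enorm p / 2 by rewrite divr_gt0.
  have Hg := grad_near dh e0.
  near=> y; have : h y \is a fin_num by near: y.
  have : `|(fine \o h) y - (fine \o h) x - dotp (grad (fine \o h) x) (y - x)| <=
    enorm p / 2 * enorm (y - x) by near: y.
  have := lbh y; rewrite [dotp p _]dotpBl /=.
  move: hx; case: (h x) => // a _; case: (h y) => // b.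
  rewrite -EFinD lee_fin /= => ab /ler_normlP[_ +] _; lra.
have cvx : (x - s *: p) @[s --> (0 : R)^'+] --> x.
  apply: cvg_at_right_filter.
  have -> : nbhs x = nbhs (x - 0 *: p) by rewrite scale0r subr0.
  by apply: cvgB; [exact: cvg_cst|apply: cvgZr_tmp; exact: cvg_id].
move=> /cvx /=; rewrite nbhs_filterE => H.
near (0 : R)^'+ => s.
have s0 : 0 < s by [].
(* This gives [s * c < 1/2], so [s/2 + c s^2] stays below [s]; the [+ 1] covers [c = 0]. *)
have : s < (2 * (c + 1))^-1.
  by near: s; apply: nbhs_right_lt; rewrite invr_gt0 mulr_gt0// ltr_wpDl.
rewrite -[X in _ < X]mul1r ltr_pdivlMr ?mulr_gt0 ?ltr_wpDl// => sc.
have : - (enorm p / 2) * enorm (x - s *: p - x) -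
  c * dotp (x - s *: p - x) (x - s *: p - x) <= dotp p (x - s *: p - x) by near: s.
rewrite [x - s *: p]addrC addrK -[- (s *: p)]scaleNr enormZ normrN gtr0_norm// !(dotpZl, dotpZr) -sqr_enorm.
set n := enorm p in n0 *.
have sn : 0 < s * n ^+ 2 by rewrite mulr_gt0// exprn_gt0.
have : 0 < (2^-1 - s * c) * (s * n ^+ 2) by rewrite mulr_gt0// subr_gt0; lra.
by nra.
Unshelve. all: by end_near. Qed.

End Subdifferential.

(** * The proximal operator weighted by a diagonal matrix *)

Section DiagonalPreconditioner.
Context {R : realType} {N : nat}.
Implicit Types (D : 'M[R]_N) (h : 'cV[R]_N -> \bar R) (x y z u m : 'cV[R]_N).

Lemma mulmx_diag_cV D u i : is_diag_mx D -> (D *m u) i 0 = D i i * u i 0.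
Proof.
move=> /is_diag_mxP dD; rewrite mxE (bigD1 i)//= big1 ?addr0// => j ji.
by rewrite dD ?mul0r// eq_sym.
Qed.

Lemma psd_diag_ge (c : R) D i : psd (D - c%:M) -> c <= D i i.
Proof.
move=> [_ /(_ (delta_mx i 0))].
rewrite /dotp (bigD1 i)//= big1 => [|j ji]; last first.
  by rewrite mxE (negbTE ji) mul0r.
rewrite mxE !eqxx mul1r addr0 mxE (bigD1 i)//= big1 => [|j ji]; last first.
  by rewrite [delta_mx _ _ _ _]mxE (negbTE ji) mulr0.
by rewrite !mxE !eqxx mulr1 addr0 subr_ge0.
Qed.

Lemma diag_unitmx D : is_diag_mx D -> (forall i, D i i != 0) -> D \in unitmx.
Proof.
move=> dD D0; have : D *m (\matrix_(i, j) ((i == j)%:R / D i i)) = 1%:M.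
  apply/matrixP => i j; rewrite mxE (bigD1 i)//= big1 ?addr0 => [|k ki].
    by rewrite !mxE mulrCA divff// mulr1.
  by move/is_diag_mxP: dD => ->; rewrite ?mul0r// eq_sym.
by move=> /mulmx1_unit[].
Qed.

(** As [D] is diagonal, each estimate splits into scalar ones with [delta <= D i i <= a / gamma].
    The upper bound controls the quadratic loss of the subgradient inequality and the size of [p];
    the lower bound gives the decrease. *)
Lemma prox_diag D h x z m (a delta gamma : R) :
  proper_ereal h -> 0 < a -> 0 < delta -> 0 < gamma -> is_diag_mx D ->
  psd (D - delta%:M) -> psd (a *: invmx D - gamma%:M) ->
  prox D a h (x - a *: (invmx D *m m)) z ->
  let p := a^-1 *: (D *m (z - x)) in
  [/\ h z \is a fin_num,
    forall y, (h z + (dotp (- (m + p)) (y - z) -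
                      (2 * gamma)^-1 * dotp (y - z) (y - z))%:E <= h y)%E,
    (h z + (dotp m (z - x) + delta / (2 * a) * dotp (z - x) (z - x))%:E <= h x)%E &
    gamma ^+ 2 * dotp p p <= dotp (z - x) (z - x)].
Proof.
move=> [hNy [x1 hx1]] a0 delta0 gamma0 dD lbD ubD pz p.
have D_ge i : delta <= D i i by exact: psd_diag_ge lbD.
have D_gt0 i : 0 < D i i by exact: lt_le_trans (D_ge i).
have D_unit : D \in unitmx by apply: diag_unitmx => // i; rewrite gt_eqF.
(* Multiply the diagonal bound [gamma <= a * invmx D i i] by [D i i]; the diagonal entries of [D]
   and its inverse are reciprocal. *)
have D_le i : gamma * D i i <= a.
  have := psd_diag_ge i ubD; rewrite mxE => /(ler_wpM2r (ltW (D_gt0 i))).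
  suff -> : a * invmx D i i * D i i = a by [].
  have /matrixP/(_ i i) := mulmxV D_unit; rewrite !mxE eqxx (bigD1 i)//= big1.
    by rewrite addr0 -mulrA [invmx D i i * _]mulrC => ->; rewrite mulr1.
  by move=> j ji; move/is_diag_mxP: dD => ->; rewrite ?mul0r// eq_sym.
set q := invmx D *m m in pz.
have qE i : D i i * q i 0 = m i 0 by rewrite -mulmx_diag_cV// mulmxA mulmxV// mul1mx.
have pE i : p i 0 = a^-1 * (D i i * (z i 0 - x i 0)).
  by rewrite mxE mulmx_diag_cV// !mxE.
clearbody p q.
(* The prox inequality with the square completed around z. *)
have key y : (h z + (dotp (- (m + p)) (y - z) -
    (2 * a)^-1 * wsqnorm D (y - z))%:E <= h y)%E.
  have E : 2^-1 * wsqnorm D (z - (x - a *: q)) - 2^-1 * wsqnorm D (y - (x - a *: q)) =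
      a * (dotp (- (m + p)) (y - z) - (2 * a)^-1 * wsqnorm D (y - z)).
    rewrite /wsqnorm /dotp mulrBr !mulr_sumr -!sumrB; apply: eq_bigr => i _.
    rewrite !mulmx_diag_cV// !mxE pE -qE.
    by field; rewrite gt_eqF.
  have := pz y; have := hNy z; have := hNy y.
  case: (h y) => [b| |//] _; last by rewrite leey.
  case: (h z) => [c| |//] _; last by rewrite gt0_muley// addey// -EFinM -EFinD leNgt ltry.
  rewrite -!EFinM -!EFinD !lee_fin => H; rewrite -subr_ge0 -(pmulr_rge0 _ a0).
  by rewrite mulrBr mulrDr -E; lra.
(* Properness supplies a point [x1] where [h] is finite, and [key x1] excludes [h z = +oo]. *)
have hz : h z \is a fin_num.
  have := key x1; move: hx1 (hNy x1) (hNy z).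
  by case: (h x1) => // b _ _; case: (h z).
split=> //.
- move=> y; apply: le_trans (key y); rewrite leeD2l// lee_fin lerD2l lerN2.
  rewrite /wsqnorm /dotp !mulr_sumr; apply: ler_sum => i _.
  rewrite mulmx_diag_cV//; set t := (y - z) i 0.
  have -> : (2 * a)^-1 * (t * (D i i * t)) = (2 * a * gamma)^-1 * (gamma * D i i) * t ^+ 2.
    by field; rewrite !gt_eqF.
  have -> : (2 * gamma)^-1 * (t * t) = (2 * a * gamma)^-1 * a * t ^+ 2.
    by field; rewrite !gt_eqF.
  by rewrite ler_wpM2r ?sqr_ge0// ler_wpM2l// invr_ge0 !mulr_ge0// ltW.
(* At [y = x] the linear term yields [D i i / a] times the square, and the quadratic loss takes back
   only half of it. *)
- apply: le_trans (key x); rewrite leeD2l// lee_fin.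
  rewrite /wsqnorm /dotp !mulr_sumr -big_split -sumrB/=; apply: ler_sum => i _.
  rewrite mulmx_diag_cV// !mxE pE.
  set t := z i 0 - x i 0; have -> : x i 0 - z i 0 = - t by rewrite opprB.
  have -> : - (m i 0 + a^-1 * (D i i * t)) * - t - (2 * a)^-1 * (- t * (D i i * - t)) =
     m i 0 * t + D i i / (2 * a) * (t * t) by field; rewrite gt_eqF.
  rewrite lerD2l ler_wpM2r -?expr2 ?sqr_ge0// ler_wpM2r//.
  by rewrite invr_ge0 mulr_ge0// ltW.
- rewrite /dotp !mulr_sumr; apply: ler_sum => i _; rewrite pE !mxE.
  set t := z i 0 - x i 0.
  have -> : gamma ^+ 2 * (a^-1 * (D i i * t) * (a^-1 * (D i i * t))) =
    (gamma * D i i / a) ^+ 2 * t ^+ 2 by field; rewrite gt_eqF.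
  rewrite -expr2 ler_piMl ?sqr_ge0// expr_le1// ?ler_pdivrMr ?mul1r//.
  by rewrite !mulr_ge0 ?invr_ge0 ?ltW.
Qed.

End DiagonalPreconditioner.

(** * One exact or inexact proximal step *)

Section ProximalStep.
Context {R : realType} {N : nat}.
Implicit Types (f : 'cV[R]_N -> R) (h : 'cV[R]_N -> \bar R).
Implicit Types (D : 'M[R]_N) (x y z u m q : 'cV[R]_N).

Lemma dotpp_lipschitz (M : R) x y :
  enorm x <= M * enorm y -> dotp x x <= M ^+ 2 * dotp y y.
Proof.
move=> xy; rewrite -!sqr_enorm -exprMn lerXn2r// nnegrE ?enorm_ge0//.
exact: le_trans (enorm_ge0 x) xy.
Qed.

Lemma smooth_expansion f (L : R) x y : 0 < L -> smooth L f ->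
  `|f y - f x - dotp (grad f x) (y - x)| <= L * dotp (y - x) (y - x).
Proof.
move=> L0 [df lipf]; rewrite -{1}(subrK x y) [y - x + x]addrC.
apply: grad_expansion => // s _; apply: le_trans (lipf _ _) _.
by rewrite addrC addKr.
Qed.

(** Half of [e] pays for the first-order remainder of [f], the other half for [c |y - x|^2] on a
    ball of radius [e / (2 (c + 1))]. *)
Lemma frechet_subdiff_composite_lower f h x q (c : R) :
  differentiable f x -> h x \is a fin_num -> 0 <= c ->
  (forall y, (h x + (dotp q (y - x) - c * dotp (y - x) (y - x))%:E <= h y)%E) ->
  frechet_subdiff (composite f h) x (grad f x + q).
Proof.
move=> df hx c0 lbh; apply: frechet_subdiffI.
  by rewrite /composite fin_numD hx.
move=> e e0; have e20 : 0 < e / 2 by rewrite divr_gt0.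
have ec0 : 0 < e / (2 * (c + 1)) by rewrite divr_gt0// mulr_gt0// ltr_wpDl.
have Hf := grad_near df e20; have He := near_enorm x ec0.
near=> y.
have : `|f y - f x - dotp (grad f x) (y - x)| <= e / 2 * enorm (y - x) by near: y.
have ye : enorm (y - x) <= e / (2 * (c + 1)) by near: y.
have := lbh y; rewrite [dotp (_ + q) _]dotpDl /composite -[dotp (y - x) _]sqr_enorm.
set n := enorm (y - x) in ye *.
have {ye} : c * n ^+ 2 <= e / 2 * n.
  have n0 : 0 <= n by exact: enorm_ge0.
  move: ye; rewrite ler_pdivlMr ?mulr_gt0 ?ltr_wpDl// => ye; nra.
move: hx; case: (h x) => // a _; case: (h y) => [b| |//].
  rewrite -!EFinD !lee_fin => H1 H2 /ler_normlP[H3 _]; lra.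
by move=> _ _ _; rewrite addey// leey.
Unshelve. all: by end_near. Qed.

Lemma frechet_subdiff_composite_diff f h x :
  differentiable f x -> (\forall y \near x, h y \is a fin_num) ->
  differentiable (fine \o h) x ->
  frechet_subdiff (composite f h) x (grad f x + grad (fine \o h) x).
Proof.
move=> df hfin dh; have hx := nbhs_singleton hfin.
apply: frechet_subdiffI; first by rewrite /composite fin_numD hx.
move=> e e0; have e20 : 0 < e / 2 by rewrite divr_gt0.
have Hf := grad_near df e20; have Hh := grad_near dh e20.
near=> y.
have : `|f y - f x - dotp (grad f x) (y - x)| <= e / 2 * enorm (y - x) by near: y.
have : `|(fine \o h) y - (fine \o h) x - dotp (grad (fine \o h) x) (y - x)| <=
  e / 2 * enorm (y - x) by near: y.
have : h y \is a fin_num by near: y.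
rewrite [dotp (_ + _) _]dotpDl /composite /=.
move: hx; case: (h x) => // a _; case: (h y) => // b _ /=.
rewrite -!EFinD !lee_fin => /ler_normlP[H1 _] /ler_normlP[H2 _]; lra.
Unshelve. all: by end_near. Qed.

(* In the inexact case the Fermat rule at z identifies the gradient of h with the
   subgradient q, which then moves to x' by the smoothness of h. *)
Lemma inexact_step f h x' z q (L L' c eps : R) :
  0 < L -> smooth L f -> 0 <= c -> h z \is a fin_num ->
  (forall y, (h z + (dotp q (y - z) - c * dotp (y - z) (y - z))%:E <= h y)%E) ->
  (x' = z /\ eps = 0) \/
    (enorm (x' - z) <= eps /\ smooth_on [set y | enorm (y - z) <= eps] L' h) ->
  let v := grad f z + q in
  [/\ h x' \is a fin_num,
    f x' + fine (h x') <= f z + fine (h z) + dotp v (x' - z)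
      + (L + (`|L'| + 1)) * dotp (x' - z) (x' - z),
    dotp (x' - z) (x' - z) <= eps ^+ 2 &
    exists2 v', frechet_subdiff (composite f h) x' v' &
      dotp v' v' <= 3 * (dotp v v + (L ^+ 2 + L' ^+ 2) * dotp (x' - z) (x' - z))].
Proof.
move=> L0 fL c0 hz lbh [[-> ->]|[x'z [hd hlip]]] v.
  have d0 u : dotp u 0 = 0 :> R by apply: big1 => i _; rewrite mxE mulr0.
  rewrite subrr !d0; split=> //; first lra.
  exists v; last by have := dotpp_ge0 v; lra.
  by apply: frechet_subdiff_composite_lower lbh => //; case: fL.
have eps0 : 0 <= eps by exact: le_trans (enorm_ge0 _) x'z.
have d0 : enorm (z - z) <= eps by rewrite subrr -(scale0r z) enormZ normr0 mul0r.
have [hzfin dhz] := hd _ d0.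
have gz : grad (fine \o h) z = q by exact: grad_eq_of_lower_bound lbh.
have [hx'fin dhx'] := hd _ x'z.
have seg (s : R) : 0 <= s <= 1 -> enorm (z + s *: (x' - z) - z) <= eps.
  move=> /andP[s0 s1]; rewrite addrC addKr enormZ ger0_norm//.
  by apply: le_trans x'z; rewrite ler_piMl ?enorm_ge0.
(* [grad_expansion] needs a positive constant, while the sign of [L'] is unknown. *)
have M0 : 0 < `|L'| + 1 by rewrite ltr_wpDl.
have hexp : `|fine (h x') - fine (h z) - dotp q (x' - z)| <=
    (`|L'| + 1) * dotp (x' - z) (x' - z).
  rewrite -gz; have := @grad_expansion _ _ (fine \o h) z (x' - z) _ M0.
  rewrite [z + (x' - z)]addrC subrK; apply=> s s01; first by have [] := hd _ (seg s s01).
  apply: le_trans (hlip _ _ (seg s s01) d0) _; rewrite [z + _]addrC addrK.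
  by rewrite ler_wpM2r ?enorm_ge0// (le_trans (ler_norm _))// lerDl.
have fexp := smooth_expansion z x' L0 fL.
split.
- exact: nbhs_singleton hx'fin.
- rewrite /v [dotp (_ + q) _]dotpDl.
  by move: hexp fexp => /ler_normlP[_ H1] /ler_normlP[_ H2]; lra.
- by rewrite -sqr_enorm lerXn2r ?nnegrE ?enorm_ge0.
exists (grad f x' + grad (fine \o h) x').
  by apply: frechet_subdiff_composite_diff => //; case: fL.
have -> : grad f x' + grad (fine \o h) x' = v + (grad f x' - grad f z)
    + (grad (fine \o h) x' - grad (fine \o h) z).
  by rewrite gz -addrA [X in v + X]addrACA -opprD [RHS]addrC subrK.
apply: le_trans (dotpp_sum3 _ _ _) _.
have := dotpp_lipschitz (fL.2 x' z); have := dotpp_lipschitz (hlip _ _ x'z d0).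
by lra.
Qed.

(** The margin [c] is the decrease left after the expansion error [L * e2] of [f]. Of [c * e2], one
    half absorbs the gradient error, one quarter the inexactness, and one quarter remains. *)
Lemma proximal_step D f h x x' z m (a delta gamma L L' c eps : R) :
  proper_ereal h -> 0 < a -> 0 < delta -> 0 < gamma -> is_diag_mx D ->
  psd (D - delta%:M) -> psd (a *: invmx D - gamma%:M) ->
  prox D a h (x - a *: (invmx D *m m)) z ->
  0 < L -> smooth L f -> 0 < c -> c + L <= delta / (2 * a) ->
  (x' = z /\ eps = 0) \/
    (enorm (x' - z) <= eps /\ smooth_on [set y | enorm (y - z) <= eps] L' h) ->
  let W := L ^+ 2 + (gamma ^+ 2)^-1 in
  let e2 := dotp (z - x) (z - x) in
  let r2 := dotp (grad f x - m) (grad f x - m) in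
  [/\ h x' \is a fin_num,
    h x \is a fin_num -> f x' + fine (h x') <= f x + fine (h x) - c / 4 * e2
      + ((2 * c)^-1 + c / (4 * W)) * r2
      + (3 * W / c + L + (`|L'| + 1)) * eps ^+ 2 &
    exists2 v, frechet_subdiff (composite f h) x' v &
      dotp v v <= (9 * (W + 1) + 3 * (L ^+ 2 + L' ^+ 2)) * (e2 + r2 + eps ^+ 2)].
Proof.
move=> h_proper a0 delta0 gamma0 dD lbD ubD pz L0 fL c0 cL x'P W e2 r2.
have [hz lbh decr p2] := prox_diag h_proper a0 delta0 gamma0 dD lbD ubD pz.
set p := a^-1 *: _ in lbh p2.
have g0 : 0 <= (2 * gamma)^-1 by rewrite invr_ge0 mulr_ge0// ltW.
have [hx' dx' u2 [v vF v2]] := inexact_step L0 fL g0 hz lbh x'P.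
have W0 : 0 < W by rewrite addr_gt0 ?invr_gt0 ?exprn_gt0.
have e20 : 0 <= e2 by exact: dotpp_ge0.
have r20 : 0 <= r2 by exact: dotpp_ge0.
set v0 := grad f z + _ in dx' v2; set u := x' - z in dx' u2 v2.
(* Split [v0] into a gradient difference of [f], the gradient error and [- p]; [W] adds the factors
   [L^2] and [gamma^-2] of the first and the last. *)
have v02 : dotp v0 v0 <= 3 * (W * e2 + r2).
  have -> : v0 = (grad f z - grad f x) + (grad f x - m) - p.
    by rewrite addrA subrK /v0 opprD addrA.
  apply: le_trans (dotpp_sum3 _ _ _) _; rewrite dotpNl dotpNr opprK.
  have := dotpp_lipschitz (fL.2 z x).
  have : dotp p p <= (gamma ^+ 2)^-1 * e2 by rewrite ler_pdivlMl ?exprn_gt0.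
  by rewrite /W /r2 /e2; lra.
split=> //.
- move=> hx.
  have t0 : 0 < c / (6 * W) by rewrite divr_gt0// mulr_gt0.
  (* The Young weight [6 W / c] is chosen so that the bound [v02] costs exactly [c / 4 * e2]. *)
  have Y1 : dotp v0 u <= c / 4 * e2 + c / (4 * W) * r2 + 3 * W / c * eps ^+ 2.
    have b0 : 0 < 6 * W / c by rewrite divr_gt0// mulr_gt0.
    have Y := dotp_young v0 u b0; rewrite invf_div in Y.
    have U := ler_wpM2l (ltW b0) u2.
    have := ler_wpM2l (ltW t0) v02.
    have -> : c / (6 * W) * (3 * (W * e2 + r2)) = 2 * (c / 4 * e2 + c / (4 * W) * r2).
      by field; rewrite gt_eqF.
    by lra.
  have Y2 : dotp (grad f x - m) (z - x) <= (2 * c)^-1 * r2 + c / 2 * e2.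
    have := dotp_young (grad f x - m) (z - x) c0; rewrite -/r2 -/e2 invfM; lra.
  have dz : fine (h z) + dotp m (z - x) + (c + L) * e2 <= fine (h x).
    move: decr; move: hz hx; case: (h z) => // b _; case: (h x) => // b' _.
    rewrite -EFinD lee_fin /= => H; move: cL => /(ler_wpM2r e20); rewrite -/e2 in H; lra.
  move: Y2; rewrite dotpBl => Y2.
  have LM0 : 0 <= L + (`|L'| + 1) by rewrite !addr_ge0// ltW.
  have := smooth_expansion x z L0 fL; rewrite -/e2 => /ler_normlP[_ fz].
  move: u2 => /(ler_wpM2l LM0) u2; lra.
exists v => //; apply: le_trans v2 _.
have K0 : 0 <= L ^+ 2 + L' ^+ 2 by rewrite addr_ge0 ?sqr_ge0.
have eps20 := sqr_ge0 eps.
move: u2 => /(ler_wpM2l K0) u2.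
have := mulr_ge0 (ltW W0) e20; have := mulr_ge0 (ltW W0) r20.
have := mulr_ge0 (ltW W0) eps20; have := mulr_ge0 K0 e20; have := mulr_ge0 K0 r20.
by lra.
Qed.

End ProximalStep.

(** * Geometric decay of the momentum error *)

Section Momentum.
Context {R : realType}.

(** Once [q * mu ^+ t <= 1/2], every bound [B >= 2 a] propagates, since [a + B / 2 <= B]; finitely
    many terms come before. [B] is chosen before [u], so it serves all realizations at once. *)
Lemma bounded_recursion (a b q mu : R) : 0 <= a -> 0 <= q -> 0 <= mu < 1 ->
  exists2 B : R, 0 <= B & forall u : nat -> R, (forall t, 0 <= u t) ->
    u 0%N <= b -> (forall t, u t.+1 <= a + q * mu ^+ t * u t) ->
    forall t, u t <= B.
Proof.
move=> a0 q0 /andP[mu0 mu1].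
have [s0 s0P] : exists s0, forall t, (s0 <= t)%N -> q * mu ^+ t <= 2^-1.
  have : q * mu ^+ t @[t --> \oo] --> q * 0.
    by apply: cvgMr; apply: cvg_expr; rewrite ger0_norm.
  rewrite mulr0 => /cvgr_le /(_ 2^-1) [|s0 _ H]; first by rewrite invr_gt0.
  by exists s0 => t st; exact: H.
(* The bound for the initial segment is built by induction and kept above [2 * a], ready for the
   contracting phase. *)
have init s : exists2 B : R, 2 * a <= B & forall u : nat -> R,
    (forall t, 0 <= u t) -> u 0%N <= b ->
    (forall t, u t.+1 <= a + q * mu ^+ t * u t) ->
    forall t, (t <= s)%N -> u t <= B.
  elim: s => [|s [B aB IH]].
    exists (2 * a + `|b|) => [|u u0 ub _ t]; first by rewrite lerDl.
    by rewrite leqn0 => /eqP ->; have := ler_norm b; lra.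
  have B0 : 0 <= B by rewrite (le_trans _ aB)// mulr_ge0.
  have qB : 0 <= q * B by rewrite mulr_ge0.
  exists (B + a + q * B) => [|u u0 ub urec t]; first by lra.
  rewrite leq_eqVlt ltnS => /predU1P[->|ts]; last first.
    by have := IH u u0 ub urec t ts; lra.
  have := IH u u0 ub urec s (leqnn s) => us.
  have : q * mu ^+ s * u s <= q * B.
    rewrite -mulrA ler_wpM2l// (le_trans _ us)// ler_piMl//.
    by rewrite exprn_ile1// ltW.
  by have := urec s; lra.
have [B aB HB] := init s0; exists B => [|u u0 ub urec t].
  by rewrite (le_trans _ aB)// mulr_ge0.
have [ts|/ltnW ts] := leqP t s0; first exact: (HB u).
rewrite -(subnK ts); elim: (t - s0)%N => [|n IH]; first exact: (HB u).
rewrite addSn; apply: le_trans (urec _) _.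
have : q * mu ^+ (n + s0) * u (n + s0)%N <= 2^-1 * B.
  apply: ler_pM => //; last by apply: s0P; rewrite leq_addl.
  by rewrite mulr_ge0// exprn_ge0.
by lra.
Qed.

Lemma sum_geometric_le (mu : R) (T : nat) : 0 <= mu < 1 ->
  \sum_(0 <= t < T) mu ^+ t <= (1 - mu)^-1.
Proof.
move=> /andP[mu0 mu1]; have mu10 : 0 < 1 - mu by rewrite subr_gt0.
rewrite -[leRHS]mul1r ler_pdivlMr// mulrC.
elim: T => [|T IH]; first by rewrite big_nil mulr0.
suff -> : (1 - mu) * \sum_(0 <= t < T.+1) mu ^+ t = 1 - mu ^+ T.+1.
  by rewrite gerBl exprn_ge0.
elim: T {IH} => [|T IH]; first by rewrite big_nat1 expr0 expr1 mulr1.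
by rewrite big_nat_recr//= mulrDr IH !exprS; ring.
Qed.

(** The error equals [rho t] times the previous estimate minus [g t], and the squared norms of the
    estimates obey [bounded_recursion]. [E] does not depend on the sequence [g]. *)
Lemma momentum_error (N : nat) (m_init : 'cV[R]_N) (rho : nat -> R)
    (rho0 mu G : R) : 0 <= mu < 1 -> (forall t, rho t = rho0 * mu ^+ t) ->
  exists2 E : R, 0 <= E & forall g : nat -> 'cV[R]_N,
    (forall t, dotp (g t) (g t) <= G ^+ 2) ->
    forall t, dotp (mean_est rho m_init g t - g t) (mean_est rho m_init g t - g t)
      <= E * mu ^+ t.
Proof.
move=> mu01 rhoE; have /andP[mu0 mu1] := mu01.
pose a := 2 * (1 + `|rho0|) ^+ 2 * G ^+ 2.
have mut1 t : mu ^+ t <= 1 by rewrite exprn_ile1// ltW.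
have mut0 t : 0 <= mu ^+ t by rewrite exprn_ge0.
(* The rate [mu^(2t)] is weakened to [mu^t], which is still summable. *)
have rho2 t : rho t ^+ 2 <= rho0 ^+ 2 * mu ^+ t.
  by rewrite rhoE exprMn ler_wpM2l ?sqr_ge0// expr2 ler_piMl.
have omrho2 t : (1 - rho t) ^+ 2 <= (1 + `|rho0|) ^+ 2.
  rewrite -[leLHS]real_normK ?num_real// lerXn2r ?nnegrE ?addr_ge0//.
  apply: le_trans (ler_normB _ _) _; rewrite normr1 lerD2l rhoE normrM.
  by rewrite ler_piMr// ger0_norm.
have a0 : 0 <= a by rewrite mulr_ge0 ?sqr_ge0// mulr_ge0 ?sqr_ge0.
have q0 : 0 <= 2 * rho0 ^+ 2 by rewrite mulr_ge0 ?sqr_ge0.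
have [B B0 HB] := bounded_recursion (dotp m_init m_init) a0 q0 mu01.
exists (2 * rho0 ^+ 2 * (B + G ^+ 2)) => [|g gG t].
  by rewrite mulr_ge0// addr_ge0// sqr_ge0.
pose prev t := if t is s.+1 then mean_est rho m_init g s else m_init.
have mE s : mean_est rho m_init g s = (1 - rho s) *: g s + rho s *: prev s.
  by case: s.
have prevB : dotp (prev t) (prev t) <= B.
  apply: (HB (fun t => dotp (prev t) (prev t))) => // [s|s]; first exact: dotpp_ge0.
  rewrite /= mE; apply: le_trans (dotpp_sum2 _ _) _.
  rewrite !(dotpZl, dotpZr) !mulrA -!expr2.
  have := ler_pM (sqr_ge0 _) (dotpp_ge0 _) (omrho2 s) (gG s).
  have := ler_wpM2r (dotpp_ge0 (prev s)) (rho2 s).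
  by rewrite /a; lra.
have -> : mean_est rho m_init g t - g t = rho t *: (prev t - g t).
  by rewrite mE scalerBl scale1r scalerBr addrAC [g t - _]addrC addrK addrC.
rewrite dotpZl dotpZr mulrA -expr2.
have H : dotp (prev t - g t) (prev t - g t) <= 2 * (B + G ^+ 2).
  apply: le_trans (dotpp_sum2 _ _) _; rewrite dotpNl dotpNr opprK.
  by rewrite ler_pM2l// lerD.
apply: le_trans (ler_pM (sqr_ge0 _) (dotpp_ge0 _) (rho2 t) H) _.
by rewrite le_eqVlt; apply/orP; left; apply/eqP; ring.
Qed.

End Momentum.

(** * Expectation over the output index, and telescoping *)

Section Averaging.
Context {R : realType}.

Lemma integral_unif_law (T : nat) (phi : nat -> \bar R) :
  (forall k, (0 <= phi k)%E) ->
  (\int[unif_law R T]_k phi k = (T%:R^-1)%:E * \sum_(t < T) phi t.+1)%E.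
Proof.
move=> phi0; rewrite ge0_integral_mscale//; congr (_ * _)%E.
rewrite ge0_integral_measure_sum//; apply: eq_bigr => t _.
by rewrite integral_dirac// diracT mul1e.
Qed.

Lemma setdist_ge0 (N : nat) (z : 'cV[R]_N) S : (0 <= setdist z S)%E.
Proof. by apply: le_ereal_inf_tmp => _ [s _ <-]; rewrite lee_fin enorm_ge0. Qed.

(** A single small subgradient bounds the distance, so no nearest point of [S] is required. *)
Lemma setdist0_sqr_le (N : nat) (S : set 'cV[R]_N) v (c : R) : S v -> dotp v v <= c ->
  (setdist 0 S ^+ 2 <= c%:E)%E.
Proof.
move=> Sv vc; have dv : (setdist 0 S <= (enorm v)%:E)%E.
  by apply: ereal_inf_lbound; exists v => //; rewrite sub0r -scaleN1r enormZ normrN1 mul1r.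
rewrite expe2; apply: le_trans (lee_pmul _ _ dv dv) _; rewrite ?setdist_ge0//.
by rewrite -EFinM lee_fin -expr2 sqr_enorm.
Qed.

Lemma telescoped_descent (Phi e r s : nat -> R) (k A B : R) (T : nat) :
  (forall t, Phi t.+1 <= Phi t - k * e t + A * r t + B * s t) ->
  k * \sum_(0 <= t < T) e t <= Phi 0%N - Phi T + A * \sum_(0 <= t < T) r t
    + B * \sum_(0 <= t < T) s t.
Proof.
move=> H; elim: T => [|T IH]; first by rewrite !big_nil !mulr0 !addr0 subrr.
by rewrite !big_nat_recr//= !mulrDr; have := H T; lra.
Qed.

End Averaging.

(** * Choice of the constants and summation over the run *)

Theorem theorem3 (R : realType) (N : nat)
  (* minibatch distribution and stochastic loss *)
  (dXi : measure_display) (Xi : measurableType dXi) (P : probability Xi R)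
  (loss : 'cV[R]_N -> Xi -> R) (f : 'cV[R]_N -> R) (h : 'cV[R]_N -> \bar R)
  (* probability space of the run, and the drawn minibatches *)
  (dOmega : measure_display) (Omega : measurableType dOmega)
  (Pr : probability Omega R) (xi : nat -> Omega -> Xi)
  (* algorithm data; eps t.+1 and xstep t.+1 belong to the t-th step *)
  (x0 m_init : 'cV[R]_N) (alpha rho : nat -> R)
  (Dmat : nat -> Omega -> 'M[R]_N)
  (x xstep : nat -> Omega -> 'cV[R]_N) (eps : nat -> Omega -> R)
  (xopt : 'cV[R]_N)
  (L sigma Dbnd G rho0 mu delta gamma L' K : R)
  (* f is the mean of the differentiable losses *)
  (loss_diff : forall s y, differentiable (loss ^~ s) y)
  (loss_int : forall y, P.-integrable setT (EFin \o loss y))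
  (f_mean : forall y, (f y)%:E = ('E_P[loss y])%E)
  (h_proper : proper_ereal h)
  (xopt_min : minimizer (composite f h) xopt)
  (* algorithm *)
  (xi_meas : forall t, measurable_fun setT (xi t))
  (xi_law : forall t A, measurable A -> Pr (xi t @^-1` A) = P A)
  (x_init : forall w, x 0%N w = x0)
  (alpha_gt0 : forall t, 0 < alpha t)
  (Dmat_diag : forall t w, is_diag_mx (Dmat t w))
  (xstepE : forall t w,
     prox (Dmat t w) (alpha t) h
       (x t w - alpha t *: (invmx (Dmat t w) *m
          mean_est rho m_init (fun s => stoch_grad loss xi x s w) t))
       (xstep t.+1 w))
  (* Assumption A *)
  (L_gt0 : 0 < L)
  (f_smooth : smooth L f)
  (f_lb : exists c, forall y, c <= f y)
  (g_unbiased : forall t w i,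
     P.-integrable setT (fun s => (grad (loss ^~ s) (x t w) i 0)%:E) /\
     ('E_P[fun s => (grad (loss ^~ s) (x t w) i 0)%R] = (grad f (x t w) i 0)%:E)%E)
  (g_variance : forall t w,
     ('E_P[fun s => ((enorm (grad (loss ^~ s) (x t w) - grad f (x t w))) ^+ 2)%R]
        <= (sigma ^+ 2)%:E)%E)
  (x_bnd : forall t w, enorm (x t.+1 w - x t w) <= Dbnd)
  (g_bnd : forall t w, enorm (stoch_grad loss xi x t w) <= G)
  (rhoE : forall t, rho t = rho0 * mu ^+ t)
  (mu_bnd : 0 <= mu < 1)
  (delta_gt0 : 0 < delta) (gamma_gt0 : 0 < gamma)
  (Dmat_lb : forall t w, psd (Dmat t w - delta%:M))
  (Dmat_ub : forall t w, psd (alpha t *: invmx (Dmat t w) - gamma%:M))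
  (* Assumption B *)
  (x_step : forall t w,
     (x t.+1 w = xstep t.+1 w /\ eps t.+1 w = 0) \/
     (enorm (x t.+1 w - xstep t.+1 w) <= eps t.+1 w /\
      smooth_on [set z | enorm (z - xstep t.+1 w) <= eps t.+1 w] L' h))
  (eps_sum : forall w,
     (\sum_(0 <= t <oo) ((eps t.+1 w) ^+ 2)%:E <= K%:E)%E)
  (* step sizes *)
  (alpha_noninc : forall t, alpha t.+1 <= alpha t)
  (alpha0_lt : alpha 0%N < delta / (2 * L)) :
  exists C1 C2 C3 : R, [/\ 0 < C1, 0 < C2, 0 < C3 &
    forall (T : nat) (w : Omega), (0 < T)%N ->
      (\int[unif_law R T]_k
         (setdist 0 (frechet_subdiff (composite f h) (x k w))) ^+ 2
       <= (C1 / T%:R *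
             \sum_(0 <= t < T)
               (enorm (stoch_grad loss xi x t w - grad f (x t w))) ^+ 2)%:E
          + (C2 / T%:R)%:E * (composite f h x0 - composite f h xopt)
          + (C3 / T%:R)%:E)%E].
Proof.
have alpha_le t : alpha t <= alpha 0%N.
  by elim: t => // t; apply: le_trans.
(* Positive by the bound on [alpha 0]; as the step sizes do not increase, the same margin serves
   every step. *)
pose c := delta / (2 * alpha 0%N) - L.
have c0 : 0 < c.
  rewrite subr_gt0 ltr_pdivlMr ?mulr_gt0//.
  by move: alpha0_lt; rewrite ltr_pdivlMr ?mulr_gt0//; lra.
have cL t : c + L <= delta / (2 * alpha t).
  by rewrite subrK ler_wpM2l ?(ltW delta_gt0)// lef_pV2 ?posrE ?mulr_gt0// ler_pM2l.
have [E E0 momE] := momentum_error m_init G mu_bnd rhoE.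
pose W := L ^+ 2 + (gamma ^+ 2)^-1.
pose A1 := (2 * c)^-1 + c / (4 * W).
pose A2 := 3 * W / c + L + (`|L'| + 1).
pose B := 9 * (W + 1) + 3 * (L ^+ 2 + L' ^+ 2).
have W0 : 0 < W by rewrite addr_gt0 ?invr_gt0 ?exprn_gt0.
have A10 : 0 < A1 by rewrite addr_gt0 ?invr_gt0 ?divr_gt0 ?mulr_gt0.
have A20 : 0 < A2.
  by apply: addr_gt0; [rewrite addr_gt0 ?divr_gt0 ?mulr_gt0|rewrite ltr_wpDl].
have B0 : 0 < B.
  apply: ltr_wpDr; first by rewrite mulr_ge0// addr_ge0 ?sqr_ge0.
  by rewrite mulr_gt0// addr_gt0.
pose k := c / 4; have k0 : 0 < k by rewrite divr_gt0.
(* [Q] counts the gradient errors twice: directly in the subgradient bound, and through the sum of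
   the [e2 t] after division by [k]. [E1] sums the geometric momentum errors. *)
pose Q := 1 + A1 / k; pose E1 := E / (1 - mu).
have Q0 : 0 < Q by rewrite addr_gt0// divr_gt0.
have E10 : 0 <= E1 by rewrite divr_ge0// subr_ge0; case/andP: mu_bnd => _ /ltW.
(* The final [+ 1] only secures strict positivity. *)
pose C3 := B * (2 * Q * E1 + (1 + A2 / k) * `|K|) + 1.
have C30 : 0 < C3.
  have K0 : 0 <= (1 + A2 / k) * `|K|.
    by rewrite mulr_ge0// addr_ge0// divr_ge0// ltW.
  have Q1 : 0 <= 2 * Q * E1 by rewrite mulr_ge0// mulr_ge0// ltW.
  by rewrite ltr_wpDl// mulr_ge0 ?(ltW B0)// addr_ge0.
exists (2 * B * Q), (B / k), C3; split=> //.
- by rewrite !mulr_gt0.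
- by rewrite divr_gt0.
move=> T w T0.
have T0' : 0 < (T%:R : R) by rewrite ltr0n.
have xoptfin : composite f h xopt \is a fin_num.
  case: h_proper => hNy [y hy]; move: (xopt_min y) (hNy xopt) (hNy y) hy.
  by rewrite /composite; case: (h xopt); case: (h y).
(* If [h x0] is infinite, the right-hand side is [+oo], because the optimal value is finite and
   [B / k] is positive. *)
have [x0fin|x0inf] := boolP (h x0 \is a fin_num); last first.
  have -> : composite f h x0 = +oo%E.
    case: h_proper => /(_ x0); rewrite /composite.
    by move: x0inf; case: (h x0) => // _ _ _; rewrite addey.
  rewrite addye; last by move: xoptfin; case: (composite f h xopt).
  rewrite gt0_muley ?lte_fin ?divr_gt0//.
  by rewrite addey// addye// leey.
pose g s := stoch_grad loss xi x s w.
pose m t := mean_est rho m_init g t.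
pose e2 t := dotp (xstep t.+1 w - x t w) (xstep t.+1 w - x t w).
pose r2 t := dotp (grad f (x t w) - m t) (grad f (x t w) - m t).
pose d2 t := enorm (g t - grad f (x t w)) ^+ 2.
have step t := proximal_step h_proper (alpha_gt0 t) delta_gt0 gamma_gt0
  (Dmat_diag t w) (Dmat_lb t w) (Dmat_ub t w) (xstepE t w) L_gt0 f_smooth c0 (cL t)
  (x_step t w).
have hfin t : h (x t w) \is a fin_num.
  by case: t => [|t]; [rewrite x_init|have [] := step t].
pose Phi t := f (x t w) + fine (h (x t w)).
have desc t : Phi t.+1 <= Phi t - k * e2 t + A1 * r2 t + A2 * eps t.+1 w ^+ 2.
  by have [_ /(_ (hfin t))] := step t.
have gG t : dotp (g t) (g t) <= G ^+ 2.
  have tG : enorm (g t) <= G by exact: g_bnd.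
  by rewrite -sqr_enorm lerXn2r// nnegrE ?enorm_ge0// (le_trans _ tG)// enorm_ge0.
(* Inserting [g t] separates the sampling error from the momentum error. *)
have r2le t : r2 t <= 2 * (d2 t + E * mu ^+ t).
  rewrite /r2 -opprB dotpNl dotpNr opprK -(subrKA (g t)).
  apply: le_trans (dotpp_sum2 _ _) _; rewrite ler_pM2l// addrC lerD//.
    by rewrite /d2 sqr_enorm.
  exact: momE.
have epsK : \sum_(0 <= t < T) eps t.+1 w ^+ 2 <= `|K|.
  apply: le_trans (ler_norm K); rewrite -lee_fin; apply: le_trans (eps_sum w).
  rewrite -sumEFin; apply: nneseries_lim_ge => n _ _.
  by rewrite lee_fin sqr_ge0.
have sumr : \sum_(0 <= t < T) r2 t <= 2 * (\sum_(0 <= t < T) d2 t + E1).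
  apply: le_trans (ler_sum _ (fun t _ => r2le t)) _.
  rewrite -mulr_sumr big_split/= -mulr_sumr ler_pM2l// lerD2l.
  by rewrite ler_wpM2l// sum_geometric_le.
have PhiT : fine (composite f h xopt) <= Phi T.
  rewrite -lee_fin fineK// (le_trans (xopt_min (x T w)))//.
  by rewrite /composite EFinD fineK.
have Phi0 : fine (composite f h x0) = Phi 0%N.
  by rewrite /Phi x_init /composite; move: x0fin; case: (h x0).
have x0fin' : composite f h x0 \is a fin_num by rewrite /composite fin_numD x0fin.
have bound : B * (\sum_(0 <= t < T) (e2 t + r2 t + eps t.+1 w ^+ 2)) <=
    2 * B * Q * (\sum_(0 <= t < T) d2 t) +
    B / k * (fine (composite f h x0) - fine (composite f h xopt)) + C3.
  have := telescoped_descent T desc; rewrite !big_split/= -Phi0.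
  set Se := \sum_(0 <= t < T) e2 t; set Sr := \sum_(0 <= t < T) r2 t.
  set Ss := \sum_(0 <= t < T) eps t.+1 w ^+ 2 => tele.
  set Sd := \sum_(0 <= t < T) d2 t in sumr *.
  set De := fine _ - fine _.
  have SeE : Se <= k^-1 * (De + A1 * Sr + A2 * Ss).
    by rewrite ler_pdivlMl// /De; lra.
  have H1 : Q * Sr <= Q * (2 * (Sd + E1)) by rewrite ler_pM2l.
  have H2 : (1 + A2 / k) * Ss <= (1 + A2 / k) * `|K|.
    by rewrite ler_pM2l// addr_gt0// divr_gt0.
  have : Se + Sr + Ss <= De / k + 2 * Q * Sd + (2 * Q * E1 + (1 + A2 / k) * `|K|).
    by move: H1 H2 SeE; rewrite /Q; lra.
  move=> /(ler_wpM2l (ltW B0)); rewrite /C3; lra.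
(* Step [t] controls the subgradient at [x t.+1], so steps [0] to [T - 1] match the output indices
   [1] to [T]. *)
have subg t : (setdist 0 (frechet_subdiff (composite f h) (x t.+1 w)) ^+ 2
    <= (B * (e2 t + r2 t + eps t.+1 w ^+ 2))%:E)%E.
  by have [_ _ [v vF v2]] := step t; exact: setdist0_sqr_le vF v2.
rewrite integral_unif_law => [|t]; last by rewrite expe_ge0// setdist_ge0.
apply: (@le_trans _ _ ((T%:R^-1)%:E *
    (B * \sum_(0 <= t < T) (e2 t + r2 t + eps t.+1 w ^+ 2))%:E)%E).
  rewrite lee_wpmul2l ?lee_fin ?invr_ge0 ?(ltW T0')// big_mkord mulr_sumr -sumEFin.
  by apply: lee_sum => t _; exact: subg.
rewrite -(fineK x0fin') -(fineK xoptfin) -EFinB -!EFinM -!EFinD lee_fin.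
apply: le_trans (ler_wpM2l _ bound) _; first by rewrite invr_ge0 ltW.
by rewrite le_eqVlt; apply/orP; left; apply/eqP; rewrite /d2; ring.
Qed.
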